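(* Let $G=(V,E)$ be a strongly connected digraph with $n>1$ vertices, let $w\in\operatorname{Sp}(V)$, let $\mathcal{G}_1,\ldots,\mathcal{G}_p$ be the principal subsets of the set $\mathcal{G}$ of cycles of $G$, and let $\mathcal{G}^*_1,\ldots,\mathcal{G}^*_l$ be the maximal elements among the principal subsets with respect to the partial order $\succ$. Then the sets $\operatorname{Co}(\mathcal{G}^*_1),\ldots,\operatorname{Co}(\mathcal{G}^*_l)$ are pairwise disjoint. Moreover, $$\mathbb{A}_G(w)=\operatorname{Co}(\mathcal{G}^*_1)\cup\cdots\cup\operatorname{Co}(\mathcal{G}^*_l)$$ is the unique minimal cover of $\mathbb{A}_G(w)$ with respect to the collection $\{\operatorname{Co}(\mathcal{G}_i)\}_{i=1}^p$.
   Context: Digraphs are finite and simple: no self-loops and at most one edge for each ordered pair of vertices; $V=\{1,\ldots,n\}$. $G$ is strongly connected if for every ordered pair $(i,j)$ of vertices there is a (directed) path from $i$ to $j$. $\operatorname{Sp}(V)$ is the set of vectors in $\mathbb{R}^n$ with all entries positive and summing to one. An infinitesimal stochastic matrix (ISM) is a real square matrix with non-negative off-diagonal entries whose rows each sum to zero. $\mathbb{A}_G$ is the set of $n\times n$ ISMs $A=(a_{ij})$ with $a_{ij}=0$ whenever $i\neq j$ and $i\to j$ is not an edge of $G$. $\mathbb{A}_G(w)$ is the set of $A\in\mathbb{A}_G$ having a simple zero eigenvalue and satisfying $A^\top w=0$. A cycle of $G$ is a subgraph of $G$ which is a directed cycle with at least two vertices; $\mathcal{G}=\{G_1,\ldots,G_k\}$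 is the set of all cycles of $G$. The ISM $C_i$ associated with $G_i$ is the ISM whose $jk$-th entry ($j\ne k$) equals $1/w_j$ if $j\to k$ is an edge of $G_i$ and $0$ otherwise; its diagonal entries are set so that each row sums to zero. A subset $\{G'_1,\ldots,G'_m\}$ of $\mathcal{G}$, with $G'_i=(V'_i,E'_i)$, is principal if the graph $(V,\cup_iE'_i)$ is strongly connected. For a subset $\mathcal{G}'=\{G_{i_1},\ldots,G_{i_m}\}$ of $\mathcal{G}$, $\operatorname{Co}(\mathcal{G}')=\{\sum_{j=1}^m\alpha_jC_{i_j}\mid\alpha_j>0\}$. Partial order on principal subsets: $\mathcal{G}_i\succ\mathcal{G}_j$ if $\operatorname{Co}(\mathcal{G}_i)\supsetneq\operatorname{Co}(\mathcal{G}_j)$. A principal subset $\mathcal{G}'$ is a maximal element if there is no principal subset $\mathcal{G}''$ with $\mathcal{G}''\succ\mathcal{G}'$. Minimal cover: for a collection of sets $\{\mathcal{A}_i\}_{i=1}^p$ with union $\mathcal{A}$, the sets $\mathcal{A}_{i_1},\ldots,\mathcal{A}_{i_l}$ form a minimal cover of $\mathcal{A}$ with respect to the collection if $\mathcal{A}=\cup_{j=1}^l\mathcal{A}_{i_j}$ and $l$ is the least integer for which such a relation holds. (Here $\mathbb{A}_G(w)$ equals the union of all $\operatorname{Co}(\mathcal{G}_i)$, $i=1,\ldots,p$.) *)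

(* Defs.v *)
From mathcomp Require Import all_boot all_order all_algebra.
From mathcomp Require Import boolp classical_sets reals.

Set Implicit Arguments.
Unset Strict Implicit.
Unset Printing Implicit Defensive.

Import Order.TTheory GRing.Theory Num.Theory.

Local Open Scope ring_scope.

(* The vertex set {1, ..., n} is 'I_n.  A digraph on 'I_n is given by its edge
   set E : {set 'I_n * 'I_n}, with (i, j) \in E when i -> j is an edge. *)

Definition loopless (n : nat) (E : {set 'I_n * 'I_n}) : Prop :=
  forall i : 'I_n, (i, i) \notin E.

Definition strongly_connected (n : nat) (E : {set 'I_n * 'I_n}) : Prop :=
  forall i j : 'I_n, connect (fun x y => (x, y) \in E) i j.

(* A subgraph is the pair (V', E') of its vertex set and its edge set. *)
Definition subgraph (n : nat) : Type :=
  ({set 'I_n} * {set 'I_n * 'I_n})%type.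

(* [next s x] is the cyclic successor of x in the sequence s. *)
Definition directed_cycle (n : nat) (H : subgraph n) : Prop :=
  exists s : seq 'I_n,
    [/\ (1 < size s)%N,
        uniq s,
        H.1 = [set x in s]%SET
      & H.2 = [set (x, next s x) | x in s]%SET].

Definition cycles (n : nat) (E : {set 'I_n * 'I_n}) : {set subgraph n} :=
  [set H : subgraph n | (H.2 \subset E) && `[< directed_cycle H >]]%SET.

Definition principals (n : nat) (E : {set 'I_n * 'I_n}) :
    {set {set subgraph n}} :=
  [set S : {set subgraph n} | (S \subset cycles E) &&
     `[< strongly_connected (\bigcup_(H in S) H.2)%SET >]]%SET.

Section RealMatrices.
Variables (R : realType) (n : nat).
Implicit Types (E : {set 'I_n * 'I_n}) (w : 'cV[R]_n) (A : 'M[R]_n).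

Definition Sp w : Prop :=
  (forall i, 0 < w i 0) /\ \sum_i w i 0 = 1.

Definition ISM A : Prop :=
  (forall i j, i != j -> 0 <= A i j) /\ (forall i, \sum_j A i j = 0).

(* Simple means of algebraic multiplicity one. *)
Definition simple_zero_eigenvalue A : Prop := mup 0 (char_poly A) = 1%N.

Definition AG E : set 'M[R]_n :=
  [set A | ISM A /\
     forall i j, i != j -> (i, j) \notin E -> A i j = 0]%classic.

Definition AGw E w : set 'M[R]_n :=
  [set A | [/\ AG E A, simple_zero_eigenvalue A & A^T *m w = 0]]%classic.

Definition cycle_ISM w (H : subgraph n) : 'M[R]_n :=
  let c j k := if (j, k) \in H.2 then (w j 0)^-1 else 0 in
  \matrix_(j, k) if j == k then - \sum_(l | l != j) c j l else c j k.

Definition Co w (S : {set subgraph n}) : set 'M[R]_n :=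
  [set A | exists2 alpha : subgraph n -> R,
     (forall H, H \in S -> 0 < alpha H)
   & A = \sum_(H in S) alpha H *: cycle_ISM w H]%classic.

Definition succ w (S T : {set subgraph n}) : Prop :=
  (Co w T `<` Co w S)%classic.

Definition maximal_principals E w : {set {set subgraph n}} :=
  [set S in principals E |
     `[< ~ exists2 T, T \in principals E & succ w T S >]]%SET.

End RealMatrices.

(* J selects members of the collection (F i), i \in D, whose union is A. *)
Definition covers (T : Type) (I : finType) (A : set T) (D : {set I})
    (F : I -> set T) (J : {set I}) : Prop :=
  J \subset D /\ A = (\bigcup_(i in [set` J]) F i)%classic.

Definition minimal_cover (T : Type) (I : finType) (A : set T) (D : {set I})
    (F : I -> set T) (J : {set I}) : Prop :=
  [/\ A = (\bigcup_(i in [set` D]) F i)%classic,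
      covers A D F J
    & forall K : {set I}, covers A D F K -> (#|J| <= #|K|)%N].

(* Main.v *)
Require Import Defs.
From mathcomp Require Import all_boot all_order all_algebra.
From mathcomp Require Import boolp classical_sets reals.

(** An ISM [A] with [A^T w = 0] is a weighted circulation, and subtracting a
    small multiple of every cycle in its support shows that it is a positive
    combination of all these cycles.  Zero is a simple eigenvalue exactly when
    the support is strongly connected, so [AGw E w] is partitioned by the
    support, the pieces being the sets [Co w S] with [S] the set of all cycles
    inside a strongly connected union of cycles.  Each principal [S] has
    [Co w S] inside the piece of [cycles (edges S)], and distinct sets of
    cycles have distinct cones, so the pieces are the maximal elements, and
    every cover needs one principal subset in each piece. *)

Set Implicit Arguments.
Unset Strict Implicit.
Unset Printing Implicit Defensive.

Import Order.TTheory GRing.Theory Num.Theory.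

Local Open Scope ring_scope.

(** * Deflation and the multiplicity of the zero eigenvalue *)

(** Since [(A - u *m v) *m u = - u], the rank-one update moves one zero eigenvalue to -1 and keeps
    the rest of the spectrum. *)
Lemma char_poly_deflate (F : fieldType) (n : nat) (A : 'M[F]_n) (u : 'cV_n)
    (v : 'rV_n) :
  A *m u = 0 -> v *m u = 1%:M ->
  ('X + 1) * char_poly A = 'X * char_poly (A - u *m v).
Proof.
move=> Au vu.
pose U : 'cV[{poly F}]_n := map_mx polyC u.
pose V : 'rV[{poly F}]_n := map_mx polyC v.
pose M := char_poly_mx A.
have VU : V *m U = 1%:M by rewrite -map_mxM vu map_mx1.
have MU : M *m U = 'X *: U.
  by rewrite mulmxBl mul_scalar_mx -map_mxM Au map_mx0 subr0.
have charE : char_poly (A - u *m v) = \det (M + U *m V).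
  rewrite /char_poly /char_poly_mx map_mxB map_mxM.
  by congr (\det _); rewrite /M /char_poly_mx opprB addrCA addrC.
(* The bordered determinant [[1, -V], [U, M]] is evaluated in two ways. *)
have detL : block_mx 1%:M (- V) U M *m block_mx 'X%:M 0 (- U) 1%:M =
            block_mx ('X + 1)%:M (- V) 0 M.
  rewrite mulmx_block !mul1mx !mulmx0 !mulmx1 !add0r mulNmx !mulmxN opprK VU.
  by rewrite MU mul_mx_scalar subrr raddfD.
have detR : block_mx 1%:M (- V) U M =
            block_mx 1%:M 0 U 1%:M *m block_mx 1%:M (- V) 0 (M + U *m V).
  rewrite mulmx_block !mul1mx !mul0mx !mulmx1 !addr0 mulmxN.
  by rewrite addrCA addNr addr0.
have := congr1 determinant detL.
rewrite det_mulmx detR det_mulmx !det_lblock !det_ublock !det1 !mul1r mulr1.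
by rewrite !det_scalar !expr1 -charE -/(char_poly A) mulrC => ->.
Qed.

(** By deflation the multiplicity is 1 exactly when [B = A - u *m v] is invertible. As
    [v *m B = - v], the kernel of [B] is the part of the kernel of [A] killed by [v]. *)
Lemma mup_char_poly_eq1 (F : fieldType) (n : nat) (A : 'M[F]_n) (u : 'cV_n)
    (v : 'rV_n) :
  A *m u = 0 -> v *m A = 0 -> v *m u = 1%:M ->
  mup 0 (char_poly A) = 1%N <->
  forall x : 'cV_n, A *m x = 0 -> v *m x = 0 -> x = 0.
Proof.
move=> Au vA vu; have eqX := char_poly_deflate Au vu.
set B := A - u *m v in eqX.
have p_neq0 (C : 'M[F]_n) : char_poly C != 0.
  by rewrite monic_neq0 ?char_poly_monic.
have mupE : mup 0 (char_poly A) = (mup 0 (char_poly B)).+1.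
  have := congr1 (mup 0) eqX; rewrite mupMr; last first.
    by rewrite rootE !hornerE oner_eq0.
  move=> ->; rewrite mupM ?polyX_eq0//.
  by have := mup_XsubCX 1 (0 : F) 0; rewrite subr0 expr1 eqxx => ->.
(* The constant coefficient of the characteristic polynomial is the determinant up to sign. *)
have mup0E : (mup 0 (char_poly B) == 0%N) = (B \in unitmx).
  rewrite eqn0Ngt -XsubC_dvd // -root_factor_theorem rootE horner_coef0.
  by rewrite char_poly_det unitmxE unitfE mulf_eq0 signr_eq0.
rewrite mupE; split=> [[/eqP]|ker0].
  rewrite mup0E => Bunit x Ax vx; rewrite -[x](mulKmx Bunit) mulmxBl Ax.
  by rewrite -mulmxA vx mulmx0 subrr mulmx0.
congr _.+1; apply/eqP; rewrite mup0E -unitmx_tr -row_free_unit.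
apply: inj_row_free => y yB; apply: trmx_inj; rewrite trmx0.
have Bx : B *m y^T = 0 by apply: trmx_inj; rewrite trmx_mul trmxK trmx0.
have vx : v *m y^T = 0.
  have := congr1 (mulmx v) Bx; rewrite mulmx0 mulmxA mulmxBr vA mulmxA vu.
  by rewrite mul1mx sub0r mulNmx => /eqP; rewrite oppr_eq0 => /eqP.
apply: ker0 => //; move: Bx.
by rewrite mulmxBl -mulmxA vx mulmx0 subr0.
Qed.

(** * Cycles of a digraph and unions of their edges *)

Section Cycles.
Variable n : nat.
Implicit Types (D : {set 'I_n * 'I_n}) (H K : subgraph n).
Implicit Types S T : {set subgraph n}.

Definition edges S : {set 'I_n * 'I_n} := (\bigcup_(H in S) H.2)%SET.

Lemma mem_next_set (s : seq 'I_n) x y :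
  ((x, y) \in [set (z, next s z) | z in s]%SET) = (x \in s) && (y == next s x).
Proof.
apply/imsetP/andP => [[z zs [-> ->]]|[xs /eqP->]]; first by rewrite eqxx.
by exists x.
Qed.

(** The only candidate edge out of [k] goes to [next s k], the only one into [k] comes from
    [prev s k], and each is present exactly when [k] is in [s]. *)
Lemma directed_cycle_degree (R : nzRingType) H k : directed_cycle H ->
  \sum_l ((k, l) \in H.2)%:R = \sum_j ((j, k) \in H.2)%:R :> R.
Proof.
case=> s [_ Us _ ->].
rewrite (bigD1 (next s k)) // [RHS](bigD1 (prev s k)) //= !mem_next_set.
rewrite next_prev // !eqxx !andbT mem_prev !big1 // => l neq.
  rewrite mem_next_set; case: eqP => [eq_k|]; last by rewrite andbF.
  by rewrite eq_k prev_next ?eqxx // in neq.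
by rewrite mem_next_set (negPf neq) andbF.
Qed.

Lemma directed_cycle_neq0 H : directed_cycle H -> exists e, e \in H.2.
Proof.
case=> -[|x s] [// _ _ _ ->]; exists (x, next (x :: s) x).
by rewrite mem_next_set mem_head /=.
Qed.

(** The two successor functions agree on [s], so [s] is stable under [next t], whose orbit of any
    vertex of [t] is all of [t]. *)
Lemma directed_cycle_subset H K :
  directed_cycle H -> directed_cycle K -> H.2 \subset K.2 -> H = K.
Proof.
case: H K => [V1 E1] [V2 E2] [s [sz_s _ /= -> ->]] [t [_ Ut /= -> ->]] /fintype.subsetP sub.
have st x : x \in s -> x \in t /\ next s x = next t x.
  move=> xs; have /sub : (x, next s x) \in [set (z, next s z) | z in s]%SET.
    by rewrite mem_next_set xs /=.
  by rewrite mem_next_set => /andP[xt /eqP].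
have eq_st : s =i t.
  case: s sz_s {sub} st => // x0 s' _; set s := x0 :: s' => st y.
  apply/idP/idP => [/st[]//|yt].
  have xs : x0 \in s by rewrite mem_head.
  have [xt _] := st _ xs.
  have : fconnect (next t) x0 y by rewrite (fconnect_cycle (cycle_next Ut)).
  move=> /iter_findex <-; elim: (findex _ _ _) => //= m IHm.
  by have [_ <-] := st _ IHm; rewrite mem_next.
congr (_, _); first by apply/setP => x; rewrite !inE eq_st.
apply/setP => -[x y]; rewrite !mem_next_set -eq_st.
by case: (boolP (x \in s)) => // /st[_ ->].
Qed.

Lemma mem_cycles D H : H \in cycles D <-> H.2 \subset D /\ directed_cycle H.
Proof.
rewrite inE; split=> [/andP[? /asboolP]//|[-> ?]].
exact/asboolP.
Qed.

Lemma cyclesS D D' : D \subset D' -> cycles D \subset cycles D'.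
Proof.
move=> sDD'; apply/fintype.subsetP => H /mem_cycles[sHD dcH].
by apply/mem_cycles; split=> //; exact: fintype.subset_trans sDD'.
Qed.

Lemma edges_cycles D : edges (cycles D) \subset D.
Proof. by apply/bigcupsP => H /mem_cycles[]. Qed.

Lemma edgesS S T : S \subset T -> edges S \subset edges T.
Proof.
move=> /fintype.subsetP sST; apply/bigcupsP => H /sST HT; exact: finset.bigcup_sup HT.
Qed.

Lemma sub_cycles_edges D S : S \subset cycles D -> S \subset cycles (edges S).
Proof.
move=> /fintype.subsetP sS; apply/fintype.subsetP => H HS; have /mem_cycles[_ dcH] := sS _ HS.
by apply/mem_cycles; split=> //; exact: finset.bigcup_sup HS.
Qed.

(** This makes [S |-> cycles (edges S)] a closure operator; its closed principal sets turn out to be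
    the maximal elements. *)
Lemma edges_cycles_edges D S :
  S \subset cycles D -> edges (cycles (edges S)) = edges S.
Proof.
move=> sS; apply/eqP; rewrite finset.eqEsubset edges_cycles.
exact/edgesS/(sub_cycles_edges sS).
Qed.

(** A return path from [y] to [x], shortened to have no repetition, is closed up by the edge from
    [x] to [y]. *)
Lemma cycle_through D x y : (x, y) \in D -> x != y ->
  connect (fun a b => (a, b) \in D) y x ->
  exists2 H, H \in cycles D & (x, y) \in H.2.
Proof.
move=> xyD neq_xy /connectP[p].
move=> /shortenP[q e_q Uq _] last_x.
have last_in : x \in y :: q by rewrite last_x mem_last.
have cyc : cycle (fun a b => (a, b) \in D) (y :: q).
  by rewrite /cycle rcons_path e_q -last_x.
have nxt : next (y :: q) x = y.
  have cq := cycle_next Uq; move: cq; rewrite /cycle rcons_path -last_x.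
  by move=> /andP[_ /eqP].
exists ([set z in y :: q]%SET, [set (z, next (y :: q) z) | z in y :: q]%SET);
  last by rewrite mem_next_set last_in nxt eqxx.
apply/mem_cycles; split.
  apply/fintype.subsetP => -[a b]; rewrite mem_next_set => /andP[aq /eqP->].
  exact: (next_cycle cyc).
exists (y :: q); split=> //.
by case: q last_x {e_q Uq last_in cyc nxt} => // eq_xy; rewrite eq_xy eqxx in neq_xy.
Qed.

End Cycles.

(** * Weighted circulations and combinations of cycles *)

Section Balanced.
Variables (R : realType) (n : nat) (w : 'cV[R]_n).
Hypothesis w_gt0 : forall i, 0 < w i 0.
Implicit Types (D : {set 'I_n * 'I_n}) (H : subgraph n) (A B : 'M[R]_n).
Implicit Types S T : {set subgraph n}.

Definition supp A : {set 'I_n * 'I_n} :=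
  [set p | (p.1 != p.2) && (A p.1 p.2 != 0)]%SET.

(** Equivalently, the row sums vanish and the flow [w i 0 * A i j] over [i != j] is conserved at
    each vertex. Signs are left out so that the condition is linear and survives subtraction. *)
Definition balanced A : Prop :=
  A *m (const_mx 1 : 'cV_n) = 0 /\ A^T *m w = 0.

Lemma row_sums0E A :
  A *m (const_mx 1 : 'cV_n) = 0 <-> forall i, \sum_j A i j = 0.
Proof.
have AE i : (A *m (const_mx 1 : 'cV_n)) i 0 = \sum_j A i j.
  by rewrite mxE; apply: eq_bigr => j _; rewrite mxE mulr1.
split=> [A1 i|sum0]; first by rewrite -AE A1 mxE.
by apply/matrixP => i j; rewrite ord1 AE sum0 mxE.
Qed.

Lemma balancedD A B : balanced A -> balanced B -> balanced (A + B).
Proof.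
by move=> [A1 Aw] [B1 Bw]; rewrite /balanced linearD !mulmxDl A1 B1 Aw Bw addr0.
Qed.

Lemma balancedZ a A : balanced A -> balanced (a *: A).
Proof.
by move=> [A1 Aw]; rewrite /balanced linearZ -!scalemxAl A1 Aw !scaler0.
Qed.

Lemma balanced_sum (I : finType) (P : pred I) (F : I -> 'M[R]_n) :
  (forall i, P i -> balanced (F i)) -> balanced (\sum_(i | P i) F i).
Proof.
move=> balF; apply: (big_ind balanced) => //; last exact: balancedD.
by rewrite /balanced trmx0 !mul0mx.
Qed.

Lemma balanced_offdiag_inj A B : balanced A -> balanced B ->
  (forall i j, i != j -> A i j = B i j) -> A = B.
Proof.
move=> [/row_sums0E A1 _] [/row_sums0E B1 _] AB; apply/matrixP => i j.
have [<-|/AB//] := eqVneq i j.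
have := etrans (A1 i) (esym (B1 i)).
rewrite (bigD1 i) //= [RHS](bigD1 i) //=.
have -> : \sum_(k | k != i) A i k = \sum_(k | k != i) B i k.
  by apply: eq_bigr => k ki; rewrite AB // eq_sym.
exact: addIr.
Qed.

Lemma cycle_ISM_offdiag H i j : i != j ->
  cycle_ISM w H i j = ((i, j) \in H.2)%:R / w i 0.
Proof.
by move=> /negPf ij; rewrite mxE ij; case: ifP => _; rewrite ?mul1r ?mul0r.
Qed.

Lemma cycle_ISM_diag H i : loopless H.2 ->
  cycle_ISM w H i i = - (\sum_l ((i, l) \in H.2)%:R) / w i 0.
Proof.
move=> lH; rewrite mxE eqxx [in RHS](bigD1 i) //= (negPf (lH i)) add0r mulNr.
congr (- _); rewrite mulr_suml; apply: eq_bigr => l _.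
by case: ifP => _; rewrite ?mul1r ?mul0r.
Qed.

(** The factor [1 / w] gives every edge of the cycle a unit flow, so conservation is equality of
    in-degree and out-degree. *)
Lemma cycle_ISM_balanced H :
  loopless H.2 -> directed_cycle H -> balanced (cycle_ISM w H).
Proof.
move=> lH dcH; split.
  apply/row_sums0E => i; rewrite (bigD1 i) //= cycle_ISM_diag //.
  rewrite [in - _](bigD1 i) //= (negPf (lH i)) add0r mulNr mulr_suml addrC.
  apply/eqP; rewrite subr_eq0; apply/eqP/eq_bigr => j ji.
  by rewrite cycle_ISM_offdiag // eq_sym.
apply/matrixP => i j; rewrite ord1 !mxE (bigD1 i) //= mxE cycle_ISM_diag //.
rewrite mulfVK ?gt_eqF // (directed_cycle_degree _ _ dcH).
rewrite [in - _](bigD1 i) //= (negPf (lH i)) add0r addrC; apply/eqP.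
rewrite subr_eq0; apply/eqP/eq_bigr => k ki.
by rewrite mxE cycle_ISM_offdiag // mulfVK ?gt_eqF.
Qed.

Lemma suppP A i j : reflect (i <> j /\ A i j <> 0) ((i, j) \in supp A).
Proof.
by rewrite inE /=; apply: (iffP andP) => -[? ?]; split; apply/eqP.
Qed.

Lemma supp_loopless A : loopless (supp A).
Proof. by move=> i; rewrite inE eqxx. Qed.

Lemma looplessS D D' : D \subset D' -> loopless D' -> loopless D.
Proof.
by move=> /fintype.subsetP sD lD' i; apply: contra (lD' i); exact: sD.
Qed.

Lemma cycles_loopless D H : loopless D -> H \in cycles D -> loopless H.2.
Proof. by move=> lD /mem_cycles[sHD _]; exact: looplessS sHD lD. Qed.

Lemma comb_balanced D S (a : subgraph n -> R) : loopless D ->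
  S \subset cycles D -> balanced (\sum_(H in S) a H *: cycle_ISM w H).
Proof.
move=> lD /fintype.subsetP sS; apply: balanced_sum => H /sS HD.
apply/balancedZ/cycle_ISM_balanced; first exact: cycles_loopless HD.
by have /mem_cycles[] := HD.
Qed.

Lemma comb_offdiag S (a : subgraph n -> R) i j : i != j ->
  (\sum_(H in S) a H *: cycle_ISM w H) i j =
  (\sum_(H in S | (i, j) \in H.2) a H) / w i 0.
Proof.
move=> ij; rewrite summxE mulr_suml [RHS]big_mkcondr /=.
apply: eq_bigr => H _; rewrite mxE cycle_ISM_offdiag //.
by case: ifP => _; rewrite ?mul1r // mul0r mulr0.
Qed.

Lemma balanced_ISM A : balanced A -> (forall i j, i != j -> 0 <= A i j) -> ISM A.
Proof. by move=> [/row_sums0E]. Qed.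

(** Positive coefficients cannot cancel off the diagonal, so the support is the whole union of
    edges. *)
Lemma Co_ISM D S A : loopless D -> S \subset cycles D -> Co w S A ->
  [/\ ISM A, balanced A & supp A = edges S].
Proof.
move=> lD sS [a a_gt0 AE].
have balA : balanced A by rewrite AE; exact: comb_balanced lD sS.
split=> //.
  apply: balanced_ISM => // i j ij; rewrite AE comb_offdiag //.
  apply: divr_ge0; last exact: ltW.
  by apply: sumr_ge0 => H /andP[/a_gt0/ltW].
apply/setP => -[i j]; apply/idP/finset.bigcupP => [|[H HS ijH]].
  move=> /suppP[/eqP ij]; rewrite AE comb_offdiag // => /eqP.
  rewrite mulf_eq0 negb_or => /andP[/eqP sum_neq0 _].
  have [H|noH] := pickP (fun H : subgraph n => (H \in S) && ((i, j) \in H.2)).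
    by move=> /andP[HS ijH]; exists H.
  by case: sum_neq0; rewrite big_pred0.
have ij : i != j.
  have HD : H \in cycles D by apply: (fintype.subsetP sS).
  apply: contraTneq ijH => ->; exact: cycles_loopless HD j.
rewrite inE /= ij AE comb_offdiag // mulf_neq0 ?invr_eq0 ?gt_eqF //.
rewrite (bigD1 H) /= ?HS // ltr_wpDr ?a_gt0 //.
by apply: sumr_ge0 => K /andP[/andP[/a_gt0/ltW]].
Qed.

(** * Flow through closed vertex sets *)

(** The image of the indicator is nonnegative: a row in [X] yields its full row sum 0, a row outside
    yields only off-diagonal entries. Its pairing with the positive [w] is 0, so it vanishes. *)
Lemma closed_indicator_ker A (X : {set 'I_n}) : ISM A -> balanced A ->
  (forall i j, i \in X -> (i, j) \in supp A -> j \in X) ->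
  A *m \col_i (i \in X)%:R = 0.
Proof.
move=> [A_ge0 A_sum] [_ Aw] clX; set u := (X in A *m X).
have uE i : (A *m u) i 0 = \sum_(k in X) A i k.
  rewrite mxE [RHS]big_mkcond /=; apply: eq_bigr => k _; rewrite mxE.
  by case: ifP; rewrite ?mulr1 ?mulr0.
have u_ge0 i : 0 <= (A *m u) i 0.
  rewrite uE; have [iX|iX] := boolP (i \in X); last first.
    by apply: sumr_ge0 => k kX; apply: A_ge0; apply: contraNneq iX => ->.
  have := A_sum i; rewrite (bigID (mem X)) /= [X in _ + X]big1 ?addr0 => [->//|k kX].
  apply/eqP; apply: contraNT (kX) => Aik; apply: (clX _ _ iX).
  by rewrite inE /= Aik andbT; apply: contraNneq kX => <-.
have sum0 : \sum_i w i 0 * (A *m u) i 0 = 0.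
  have wAu : (w^T *m (A *m u)) 0 0 = 0.
    by rewrite mulmxA -[w^T *m A]trmxK trmx_mul trmxK Aw trmx0 mul0mx mxE.
  by rewrite -[RHS]wAu [RHS]mxE; apply: eq_bigr => i _; rewrite [w^T _ _]mxE.
apply/matrixP => i j; rewrite ord1 [RHS]mxE; apply/eqP.
have /eqP : w i 0 * (A *m u) i 0 = 0.
  by apply: (psumr_eq0P _ sum0) => // k _; exact/mulr_ge0/u_ge0/ltW.
by rewrite mulf_eq0 gt_eqF.
Qed.

(** By conservation, a set that no flow leaves is a set that no flow enters. *)
Lemma closed_supp_backward A (X : {set 'I_n}) : ISM A -> balanced A ->
  (forall i j, i \in X -> (i, j) \in supp A -> j \in X) ->
  forall i j, (i, j) \in supp A -> j \in X -> i \in X.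
Proof.
move=> ismA balA clX i j ijA jX; apply/negPn/negP => iX.
have [A_ge0 _] := ismA.
have /matrixP/(_ i 0) := closed_indicator_ker ismA balA clX.
rewrite !mxE => sum0; have /suppP[_] := ijA; apply.
have Ai_ge0 k : 0 <= A i k * (\col_i (i \in X)%:R : 'cV_n) k 0.
  rewrite mxE; have [kX|] := boolP (k \in X); last by rewrite mulr0.
  by rewrite mulr1; apply: A_ge0; apply: contraNneq iX => ->.
have := @psumr_eq0P _ _ predT _ (fun k _ => Ai_ge0 k) sum0 j isT.
by rewrite mxE jX mulr1.
Qed.

(** The set reachable from [j] is closed, hence contains the predecessor [i] of [j]; this supplies
    the return path. *)
Lemma cycle_in_supp A i j : ISM A -> balanced A -> (i, j) \in supp A ->
  exists2 H, H \in cycles (supp A) & (i, j) \in H.2.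
Proof.
move=> ismA balA ijA; apply: cycle_through => //; first by apply/eqP; case/suppP: ijA.
pose X := [set k | connect (fun a b => (a, b) \in supp A) j k]%SET.
suff : i \in X by rewrite inE.
apply: (closed_supp_backward ismA balA _ ijA); last by rewrite inE connect0.
move=> a b; rewrite !inE => ja ab; apply: connect_trans ja _.
by apply: connect1; rewrite inE.
Qed.

(** * Decomposition of circulations into cycles *)

(** The bound keeps [t] below the flow on every edge of [H], and these edges already belong to the
    support. *)
Lemma sub_cycle_nonneg A H t : ISM A -> balanced A ->
  H \in cycles (supp A) ->
  (forall e, e \in H.2 -> t <= w e.1 0 * A e.1 e.2) ->
  let B := A - t *: cycle_ISM w H in
  [/\ ISM B, balanced B & supp B \subset supp A].
Proof.
move=> ismA balA HA le_t B; have [A_ge0 _] := ismA.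
have lH := cycles_loopless (@supp_loopless A) HA.
have /mem_cycles[/fintype.subsetP sHA dcH] := HA.
have balB : balanced B.
  by rewrite /B -scaleNr; apply/balancedD/balancedZ/cycle_ISM_balanced.
have BE i j : i != j -> B i j = A i j - t * (((i, j) \in H.2)%:R / w i 0).
  by move=> ij; rewrite 3!mxE cycle_ISM_offdiag.
split=> //.
  apply: balanced_ISM => // i j ij; rewrite BE //.
  case: (boolP (_ \in _)) => [/le_t /= le_tw|_].
    by rewrite mul1r subr_ge0 ler_pdivrMr // mulrC.
  by rewrite mul0r mulr0 subr0 A_ge0.
apply/fintype.subsetP => -[i j] /suppP[/eqP ij Bij].
have [/sHA//|nijH] := boolP ((i, j) \in H.2).
apply/suppP; split; first exact/eqP.
by move: Bij; rewrite BE // (negPf nijH) mul0r mulr0 subr0.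
Qed.

(** Induction on the size of the support: removing from a cycle its least edge flow deletes at least
    one edge. *)
Lemma balanced_cycle_decomposition D A : loopless D ->
  ISM A -> balanced A -> supp A \subset D ->
  exists2 b : subgraph n -> R, (forall H, 0 <= b H) &
    A = \sum_(H in cycles D) b H *: cycle_ISM w H.
Proof.
move=> lD; have [m] := ubnP #|supp A|; elim: m A => // m IHm A ltAm ismA balA sAD.
have [supp0|[[i j] ijA]] := set_0Vmem (supp A).
  exists (fun=> 0) => //; rewrite big1 => [|H _]; last by rewrite scale0r.
  apply: balanced_offdiag_inj => // [|i j ij]; first by rewrite /balanced trmx0 !mul0mx.
  apply/eqP; have : (i, j) \notin supp A by rewrite supp0 inE.
  by rewrite inE /= ij mxE negbK.
have [H HA ijH] := cycle_in_supp ismA balA ijA.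
have [[x y] xyH min_t] :=
  arg_minP (fun e : 'I_n * 'I_n => w e.1 0 * A e.1 e.2) ijH.
set t := w x 0 * A x y.
have [ismB balB sBA] := sub_cycle_nonneg ismA balA HA min_t.
set B := A - _ in ismB balB sBA.
have HD : H \in cycles D by apply: (fintype.subsetP (cyclesS sAD)).
have xyA : (x, y) \in supp A.
  by have /mem_cycles[/fintype.subsetP sHA _] := HA; exact: sHA.
have xy : x != y by apply/eqP; case/suppP: xyA.
(* The bottleneck edge [(x, y)] now carries no flow. *)
have ltBA : (#|supp B| < #|supp A|)%N.
  apply: proper_card; apply/properP; split=> //; exists (x, y) => //.
  apply/negP => /suppP[_]; apply; rewrite 3!mxE cycle_ISM_offdiag //.
  by rewrite [_ \in _]xyH mul1r mulrAC mulfV ?gt_eqF // mul1r subrr.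
have [||b b_ge0 BE] := IHm _ _ ismB balB.
- exact: leq_trans ltBA _.
- exact: fintype.subset_trans sBA sAD.
have t_ge0 : 0 <= t by case: ismA => A_ge0 _; apply: mulr_ge0; [exact: ltW|exact: A_ge0].
exists (fun K => b K + (K == H)%:R * t).
  by move=> K; rewrite addr_ge0 // mulr_ge0.
under eq_bigr do rewrite scalerDl; rewrite big_split /= -BE.
rewrite [X in _ + X](bigD1 H) //= eqxx mul1r big1 ?addr0 => [|K /andP[_ /negPf->]].
  by rewrite /B subrK.
by rewrite mul0r scale0r.
Qed.

Lemma pos_lower_bound (I : finType) (P : pred I) (f : I -> R) :
  (forall i, P i -> 0 < f i) ->
  exists2 eps, 0 < eps & forall i, P i -> eps <= f i.
Proof.
move=> f_gt0; have [i0 Pi0|P0] := pickP P; last by exists 1 => // i; rewrite P0.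
by have [i Pi min_i] := arg_minP f Pi0; exists (f i) => //; exact: f_gt0.
Qed.

(* Subtracting a small multiple of every cycle in the support leaves a
   nonnegative circulation, so that the coefficients can be taken positive on
   all these cycles at once. *)
Lemma balanced_Co_supp A : ISM A -> balanced A -> Co w (cycles (supp A)) A.
Proof.
move=> ismA balA; have [A_ge0 _] := ismA; have lA := @supp_loopless A.
set S := cycles (supp A); pose C := \sum_(H in S) 1 *: cycle_ISM w H.
have balC : balanced C by exact: (comb_balanced _ lA).
(* The number of cycles of the support through the edge. *)
pose N i j : R := \sum_(H in S | (i, j) \in H.2) 1.
have N_ge0 i j : 0 <= N i j by exact: sumr_ge0.
(* Dividing by [1 + N] makes [eps * N] at most the flow on each edge, with a denominator that is
   never zero. *)
have [e|eps eps_gt0 le_eps] := @pos_lower_bound _ (mem (supp A))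
    (fun e => w e.1 0 * A e.1 e.2 / (1 + N e.1 e.2)).
  case: e => i j /suppP[/eqP ij /eqP Aij] /=.
  by rewrite divr_gt0 ?ltr_wpDr // mulr_gt0 // lt_def Aij A_ge0.
pose B := A - eps *: C.
have BE i j : i != j -> B i j = A i j - eps * (N i j / w i 0).
  by move=> ij; rewrite !mxE -comb_offdiag // -/C.
have balB : balanced B by rewrite /B -scaleNr; exact/balancedD/balancedZ.
have N0 i j : (i, j) \notin supp A -> N i j = 0.
  move=> ijA; rewrite /N big1 // => H /andP[/mem_cycles[/fintype.subsetP sH _] /sH].
  by rewrite (negPf ijA).
have ismB : ISM B.
  apply: balanced_ISM => // i j ij; rewrite BE //.
  have [/le_eps /=|/N0->] := boolP ((i, j) \in supp A); last first.
    by rewrite mul0r mulr0 subr0 A_ge0.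
  rewrite ler_pdivlMr ?ltr_wpDr // subr_ge0 mulrA ler_pdivrMr //.
  rewrite mulrDr mulr1 [A i j * _]mulrC; apply: le_trans.
  by rewrite lerDr ltW.
have [|b b_ge0 BC] := balanced_cycle_decomposition lA ismB balB.
  apply/fintype.subsetP => -[i j] /suppP[/eqP ij]; rewrite BE // => Bij.
  apply/negPn/negP => ijA; case: Bij; move: (ijA).
  by rewrite N0 // inE /= ij negbK => /eqP->; rewrite mul0r mulr0 subr0.
exists (fun H => b H + eps) => [H _|]; first exact: ltr_wpDl.
under eq_bigr do rewrite scalerDl; rewrite big_split /= -BC /B -scaler_sumr.
suff -> : C = \sum_(H in S) cycle_ISM w H by rewrite subrK.
by apply: eq_bigr => H _; rewrite scale1r.
Qed.

(** * Simplicity of zero and strong connectivity *)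

Lemma connect_closed D (X : {set 'I_n}) i j :
  (forall a b, a \in X -> (a, b) \in D -> b \in X) ->
  connect (fun a b => (a, b) \in D) i j -> i \in X -> j \in X.
Proof.
move=> clX /connectP[p + ->]; elim: p i => //= a p IHp i /andP[ia /IHp pX] iX.
exact/pX/(clX _ _ iX).
Qed.

(** With [u] the all-ones vector and [v = w^T], simplicity says that a kernel vector of [w]-mean 0
    vanishes. Indicators of reachable sets give one direction, a maximum principle the other. *)
Lemma simple_zero_strongly_connected A : \sum_i w i 0 = 1 ->
  ISM A -> balanced A ->
  simple_zero_eigenvalue A <-> strongly_connected (supp A).
Proof.
move=> w_sum1 ismA balA; have [A_ge0 A_sum] := ismA; have [A1 Aw] := balA.
have wA : w^T *m A = 0 by rewrite -[A]trmxK -trmx_mul Aw trmx0.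
have w1 : w^T *m (const_mx 1 : 'cV_n) = 1%:M.
  apply/matrixP => i j; rewrite !ord1 mxE [RHS]mxE eqxx -[RHS]w_sum1.
  by apply: eq_bigr => k _; rewrite !mxE mulr1.
rewrite /simple_zero_eigenvalue (mup_char_poly_eq1 A1 wA w1).
split=> [ker0 i j|sc x Ax wx].
  pose X := [set k | connect (fun a b => (a, b) \in supp A) i k]%SET.
  have clX a b : a \in X -> (a, b) \in supp A -> b \in X.
    rewrite !inE => ia ab; apply: connect_trans ia _.
    by apply: connect1; rewrite inE.
  pose u : 'cV[R]_n := \col_k (k \in X)%:R.
  have Au : A *m u = 0 := closed_indicator_ker ismA balA clX.
  (* Subtracting its [w]-mean [c] from the indicator gives a kernel vector of mean 0, so the
     indicator is constant. *)
  pose c := (w^T *m u) 0 0.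
  have := ker0 (u - c *: const_mx 1).
  rewrite !mulmxBr -!scalemxAr Au A1 w1 scaler0 subrr scalemx1.
  rewrite [w^T *m u]mx11_scalar -/c subrr => /(_ erefl erefl) /matrixP u_c.
  have uE k : (k \in X)%:R = c.
    by have /eqP := u_c k 0; rewrite !mxE mulr1 subr_eq0 => /eqP.
  have := uE j; rewrite -(uE i) !inE connect0.
  by case: (connect _ _ _) => // /eqP; rewrite eq_sym oner_eq0.
have x_const i j : x i 0 = x j 0.
  (* Maximum principle: the set where [x] is maximal is closed along edges, hence contains every
     vertex. *)
  suff x_max k : x k 0 = x [arg max_(k > i) x k 0]%O 0 by rewrite !x_max.
  case: arg_maxP => // m _ max_m.
  pose X := [set k | x k 0 == x m 0]%SET.
  suff : k \in X by rewrite inE => /eqP.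
  apply: (connect_closed _ (sc m k)); last by rewrite inE.
  move=> a b; rewrite !inE => /eqP xa ab.
  have term_ge0 l : 0 <= A a l * (x m 0 - x l 0).
    have [<-|al] := eqVneq a l; first by rewrite xa subrr mulr0.
    by apply: mulr_ge0; [exact: A_ge0|rewrite subr_ge0; exact: max_m].
  have sum0 : \sum_l A a l * (x m 0 - x l 0) = 0.
    under eq_bigr do rewrite mulrBr; rewrite sumrB -mulr_suml A_sum mul0r sub0r.
    by have /matrixP/(_ a 0) := Ax; rewrite !mxE => ->; rewrite oppr0.
  have /eqP := @psumr_eq0P _ _ predT _ (fun l _ => term_ge0 l) sum0 b isT.
  rewrite mulf_eq0 subr_eq0 eq_sym => /orP[/eqP Aab|]; last by rewrite eq_sym.
  by move: ab; rewrite Aab eqxx andbF.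
apply/matrixP => i j; rewrite ord1 [RHS]mxE.
have /matrixP/(_ 0 0) := wx; rewrite mxE [RHS]mxE => wx0.
rewrite -[LHS]mul1r -[X in X * _]w_sum1 mulr_suml -[RHS]wx0.
by apply: eq_bigr => k _; rewrite [w^T _ _]mxE (x_const i k).
Qed.

Lemma AGwP D A : \sum_i w i 0 = 1 ->
  AGw D w A <->
  [/\ ISM A, balanced A, supp A \subset D & strongly_connected (supp A)].
Proof.
move=> w_sum1; split=> [[[ismA A_D] simA Aw]|[ismA balA sAD scA]].
  have balA : balanced A by split=> //; apply/row_sums0E; case: ismA.
  split=> //; last exact/simple_zero_strongly_connected.
  apply/fintype.subsetP => -[i j] /suppP[/eqP ij Aij].
  by apply/negPn/negP => /(A_D _ _ ij).
split; last by case: balA.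
  split=> // i j ij ijD; apply/eqP; apply: contraNT ijD => Aij.
  by apply: (fintype.subsetP sAD); rewrite inE /= ij.
exact/simple_zero_strongly_connected.
Qed.

(* If a cycle C of T were missing from S, give C a huge weight and every other
   cycle of T the weight 1: in a decomposition over S every cycle has an edge
   off C, which bounds its coefficient, so S cannot supply the flow along C. *)
Lemma Co_subset D S T : loopless D -> S \subset cycles D -> T \subset cycles D ->
  (Co w T `<=` Co w S)%classic -> T \subset S.
Proof.
move=> lD /fintype.subsetP sS /fintype.subsetP sT sub; apply/fintype.subsetP => C CT.
apply/negPn/negP => CS.
have /mem_cycles[/fintype.subsetP sCD dcC] := sT _ CT.
(* An edge off [C] carries flow at most [t], so every coefficient over [S] is at most [t] and no
   edge gets more than [#|S| * t], which is [K - 1]. *)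
pose t : R := #|T|%:R; pose K := 1 + #|S|%:R * t.
have t_ge0 : 0 <= t by exact: ler0n.
have K_gt0 : 0 < K by rewrite ltr_wpDr // mulr_ge0.
pose a H := if H == C then K else 1.
have a_gt0 H : 0 < a H by rewrite /a; case: ifP.
have [|b b_gt0 /matrixP AE] := sub (\sum_(H in T) a H *: cycle_ISM w H).
  by exists a.
have flowE i j : i != j ->
    \sum_(H in T | (i, j) \in H.2) a H = \sum_(H in S | (i, j) \in H.2) b H.
  move=> ij; have := AE i j; rewrite !comb_offdiag //.
  by apply: mulIf; rewrite invr_eq0 gt_eqF.
have edge_neq H i j : H \in cycles D -> (i, j) \in H.2 -> i != j.
  by move=> HD; apply: contraTneq => ->; exact: cycles_loopless HD j.
have le_b H e : H \in S -> e \in H.2 -> b H <= \sum_(K in S | e \in K.2) b K.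
  move=> HS eH; rewrite (bigD1 H) /= ?HS // lerDl.
  by apply: sumr_ge0 => L /andP[/andP[/b_gt0/ltW]].
have b_le H : H \in S -> b H <= t.
  move=> HS; have HD := sS _ HS; have /mem_cycles[_ dcH] := HD.
  have /fintype.subsetPn[[i j] ijH ijC] : ~~ (H.2 \subset C.2).
    apply/negP => /(directed_cycle_subset dcH dcC) eqHC.
    by rewrite -eqHC HS in CS.
  apply: le_trans (le_b _ _ HS ijH) _; rewrite -flowE ?(edge_neq H) //.
  rewrite /t -sum1_card natr_sum big_mkcondr /=; apply: ler_sum => L _.
  rewrite /a; case: ifP => [ijL|]; last by rewrite ler01.
  by case: eqP => // eqLC; rewrite -eqLC ijL in ijC.
have [[i j] ijC] := directed_cycle_neq0 dcC.
have CD : C \in cycles D by exact: sT.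
have K_le : K <= \sum_(H in T | (i, j) \in H.2) a H.
  rewrite (bigD1 C) /= ?CT // {1}/a eqxx lerDl.
  by apply: sumr_ge0 => L _; exact: ltW.
suff : K <= #|S|%:R * t by rewrite /K gerDr ler10.
apply: le_trans K_le _; rewrite flowE ?(edge_neq C) //.
rewrite big_mkcondr /= mulr_natl -sumr_const; apply: ler_sum => H HS.
by case: ifP => _ //; exact: b_le.
Qed.

(** * Cones sharing a matrix, and the maximal principal subsets *)

Lemma Co_neq0 S : exists A, Co w S A.
Proof. by exists (\sum_(H in S) 1 *: cycle_ISM w H); exists (fun=> 1). Qed.

(** Both unions are the support of the common matrix. *)
Lemma Co_edges D S T A : loopless D -> S \subset cycles D ->
  T \subset cycles D -> Co w S A -> Co w T A -> edges S = edges T.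
Proof. by move=> lD sS sT /(Co_ISM lD sS)[_ _ <-] /(Co_ISM lD sT)[]. Qed.

Lemma Co_cycles_edges D S : loopless D -> S \subset cycles D ->
  (Co w S `<=` Co w (cycles (edges S)))%classic.
Proof.
by move=> lD sS A /(Co_ISM lD sS)[ismA balA <-]; exact: balanced_Co_supp.
Qed.

Lemma mem_principals D S :
  S \in principals D <-> S \subset cycles D /\ strongly_connected (edges S).
Proof.
rewrite inE; split=> [/andP[? /asboolP]//|[-> ?]]; exact/asboolP.
Qed.

Lemma cycles_edges_principal D S :
  S \in principals D -> cycles (edges S) \in principals D.
Proof.
move=> /mem_principals[sS scS]; apply/mem_principals; split.
  exact/cyclesS/(fintype.subset_trans (edgesS sS))/edges_cycles.
by rewrite (edges_cycles_edges sS).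
Qed.

(** If [S] is not closed, its closure has a strictly larger cone by [Co_subset]. If [S] is closed
    and the cone of [T] contains that of [S], then [T] has the same edges, so its cone lies in that
    of the closure, which is [S]. *)
Lemma mem_maximal_principals D S : loopless D ->
  S \in maximal_principals D w <->
  S \in principals D /\ S = cycles (edges S).
Proof.
move=> lD; rewrite inE; split=> [/andP[SD /asboolP maxS]|[SD S_cl]].
  have clD := cycles_edges_principal SD.
  have /mem_principals[sS _] := SD; have /mem_principals[sclS _] := clD.
  split=> //; apply/eqP; rewrite finset.eqEsubset (sub_cycles_edges sS) /=.
  apply: (Co_subset lD sS sclS); apply: contrapT => not_sub; apply: maxS.
  by exists (cycles (edges S)) => //; split=> //; exact: Co_cycles_edges lD sS.
rewrite SD; apply/asboolP => -[T TD [sub nsub]]; apply: nsub.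
have /mem_principals[sS _] := SD; have /mem_principals[sT _] := TD.
have [A AS] := Co_neq0 S.
rewrite S_cl (Co_edges lD sS sT AS (sub _ AS)).
exact: Co_cycles_edges lD sT.
Qed.

Lemma Co_AGw D S A : \sum_i w i 0 = 1 -> loopless D -> S \in principals D ->
  Co w S A -> AGw D w A.
Proof.
move=> w_sum1 lD /mem_principals[sS scS] /(Co_ISM lD sS)[ismA balA suppE].
apply/(AGwP _ _ w_sum1); rewrite suppE; split=> //.
exact/(fintype.subset_trans (edgesS sS))/edges_cycles.
Qed.

(** The witness is the set of all cycles in the support of [A]. *)
Lemma AGw_Co_maximal D A : \sum_i w i 0 = 1 -> loopless D -> AGw D w A ->
  exists2 S, S \in maximal_principals D w & Co w S A.
Proof.
move=> w_sum1 lD /(AGwP _ _ w_sum1)[ismA balA sAD scA].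
have sS := cyclesS sAD; have AS := balanced_Co_supp ismA balA.
have [_ _ edgesE] := Co_ISM lD sS AS.
exists (cycles (supp A)) => //; apply/(mem_maximal_principals _ lD).
by rewrite -edgesE; split=> //; apply/mem_principals; rewrite -edgesE.
Qed.

Lemma AGw_bigcup_maximal D : \sum_i w i 0 = 1 -> loopless D ->
  AGw D w = (\bigcup_(S in [set` maximal_principals D w]) Co w S)%classic.
Proof.
move=> w_sum1 lD; apply/seteqP; split=> [A /AGw_Co_maximal[]// S|A [S /=]].
  by exists S.
by move=> /(mem_maximal_principals _ lD)[SD _]; exact: Co_AGw.
Qed.

Lemma AGw_bigcup_principals D : \sum_i w i 0 = 1 -> loopless D ->
  AGw D w = (\bigcup_(S in [set` principals D]) Co w S)%classic.
Proof.
move=> w_sum1 lD; apply/seteqP; split=> [A /AGw_Co_maximal[]// S|A [S /= SD]].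
  by move=> /(mem_maximal_principals _ lD)[SD _] AS; exists S.
exact: Co_AGw.
Qed.

(** * Minimality and uniqueness of the cover *)

(** A member of [K] whose cone meets that of a maximal [S] has the edges of [S], hence closure
    [S]. *)
Lemma maximal_sub_cover D (K : {set {set subgraph n}}) :
  \sum_i w i 0 = 1 -> loopless D ->
  covers (AGw D w) (principals D) (Co w) K ->
  maximal_principals D w \subset [set cycles (edges S) | S in K]%SET.
Proof.
move=> w_sum1 lD [/fintype.subsetP sK coverK]; apply/fintype.subsetP => S.
move=> /(mem_maximal_principals _ lD)[SD S_cl].
have [A AS] := Co_neq0 S; have := Co_AGw w_sum1 lD SD AS.
rewrite coverK => -[T /= TK AT]; apply/imsetP; exists T => //.
have /mem_principals[sS _] := SD; have /mem_principals[sT _] := sK _ TK.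
by rewrite {1}S_cl (Co_edges lD sS sT AS AT).
Qed.

Lemma maximal_principals_minimal D : \sum_i w i 0 = 1 -> loopless D ->
  minimal_cover (AGw D w) (principals D) (Co w) (maximal_principals D w).
Proof.
move=> w_sum1 lD; split; first exact: AGw_bigcup_principals.
  split; last exact: AGw_bigcup_maximal.
  by apply/fintype.subsetP => S /(mem_maximal_principals _ lD)[].
move=> K /(maximal_sub_cover w_sum1 lD)/subset_leq_card.
by move/leq_trans; apply; exact: leq_imset_card.
Qed.

(** Minimality leaves [J] one set per closure; that set alone must cover the cone of its closure, so
    it is closed. *)
Lemma minimal_cover_unique D (J : {set {set subgraph n}}) :
  \sum_i w i 0 = 1 -> loopless D ->
  minimal_cover (AGw D w) (principals D) (Co w) J ->
  J = maximal_principals D w.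
Proof.
move=> w_sum1 lD [_ coverJ minJ].
have [_ coverM _] := maximal_principals_minimal w_sum1 lD.
have leJM := minJ _ coverM.
have leMcl := subset_leq_card (maximal_sub_cover w_sum1 lD coverJ).
(* The image of [J] contains all maximal elements, and [J] has no more members than there are of
   these. *)
have cl_inj : {in J &, injective (fun S => cycles (edges S))}.
  apply/imset_injP; rewrite eqn_leq leq_imset_card /=.
  exact: leq_trans leJM leMcl.
have [/fintype.subsetP sJ AE] := coverJ.
apply/eqP; rewrite eqEcard; apply/andP; split; last first.
  exact: leq_trans leMcl (leq_imset_card _ _).
apply/fintype.subsetP => T TJ; have TD := sJ _ TJ.
have clD := cycles_edges_principal TD.
have /mem_principals[sT _] := TD; have /mem_principals[scl _] := clD.
apply/(mem_maximal_principals _ lD); split=> //; apply/eqP.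
rewrite finset.eqEsubset (sub_cycles_edges sT) /=.
apply: (Co_subset lD sT scl) => A Acl.
have := Co_AGw w_sum1 lD clD Acl; rewrite AE => -[T' /= T'J AT'].
have /mem_principals[sT' _] := sJ _ T'J.
suff <- : T' = T by [].
apply: cl_inj => //; rewrite -(Co_edges lD scl sT' Acl AT').
by rewrite (edges_cycles_edges sT).
Qed.

End Balanced.

Theorem proposition11 (R : realType) (n : nat) (E : {set 'I_n * 'I_n})
    (w : 'cV[R]_n) :
  (1 < n)%N -> loopless E -> strongly_connected E -> Sp w ->
  [/\ trivIset [set` maximal_principals E w]%classic (Co w),
      AGw E w = (\bigcup_(S in [set` maximal_principals E w]) Co w S)%classic,
      minimal_cover (AGw E w) (principals E) (Co w) (maximal_principals E w)
    & forall J : {set {set subgraph n}},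
        minimal_cover (AGw E w) (principals E) (Co w) J ->
        J = maximal_principals E w].
Proof.
move=> _ lE _ [w_gt0 w_sum1]; split.
(* A common matrix gives equal edge unions, and closed sets are determined by theirs. *)
- move=> S T /= /(mem_maximal_principals w_gt0 _ lE)[SE S_cl].
  move=> /(mem_maximal_principals w_gt0 _ lE)[TE T_cl] [A [AS AT]].
  have /mem_principals[sS _] := SE; have /mem_principals[sT _] := TE.
  by rewrite S_cl T_cl (Co_edges w_gt0 lE sS sT AS AT).
- exact: AGw_bigcup_maximal.
- exact: maximal_principals_minimal.
- by move=> J; exact: minimal_cover_unique.
Qed.
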